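(* Let $\eta$ be any positive equivalence relation such that there is at least one finitely learnable $\eta$-family. Then there is an $\eta$-family that is confidently learnable but not finitely learnable.
   Context: A positive equivalence relation is an equivalence relation $\eta$ on $\mathbb{N}$ that is recursively enumerable (as a set of pairs) and has infinitely many equivalence classes. A set is $\eta$-closed if it is a union of $\eta$-classes. An $\eta$-family is an infinite family of $\eta$-closed sets possessing a uniformly r.e. one-one numbering $B_0,B_1,\dots$ (i.e. $\{\langle k,x\rangle:x\in B_k\}$ is r.e. and $B_i\neq B_j$ for $i\ne j$). $W_0,W_1,\dots$ is a fixed acceptable numbering of the r.e. sets. A text for $L$ is a total $T:\mathbb N\to\mathbb N\cup\{\#\}$ whose range minus $\{\#\}$ is $L$; $T[n]$ is its initial segment of length $n$. A learner is a recursive function $M$ from finite sequences over $\mathbb N\cup\{\#\}$ to $\mathbb N\cup\{?\}$; an output $e$ is interpreted as the hypothesis ''the $\eta$-closure of $W_e$''. A family $\mathcal C$ is explanatorily learnable if some $M$, on every text $T$ for every $L\in\mathcal C$, outputs from some point on a single index whose hypothesis equals $L$; confidently learnable if some $M$ explanatorily learns $\mathcal C$ and on every text for every set $L\subseteq\mathbb N$ the sequence $M(T[n])$ converges; finitely learnable if some $M$, on every text $T$ for every $L\in\mathcal C$, has an $n$ with $M(T[m])=?$ for all $m<n$, $M(T[j])=M(T[n])$ for all $j\ge n$, and the hypothesis of $M(T[n])$ equal to $L$. *)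

(* Defs.v *)
From Corelib Require Import RelationClasses.
From mathcomp Require Import all_boot.
From mathcomp Require Import boolp classical_sets functions cardinality.

Set Implicit Arguments.
Unset Strict Implicit.
Unset Printing Implicit Defensive.

Local Open Scope classical_set_scope.

(* Programs for the partial recursive (mu-recursive) functions.  Programs carry
   no arity: a k-ary partial function is the restriction of a program to
   argument lists of size k. *)
Inductive prog : Type :=
| Zero
| Succ
| Proj of nat
| Comp of prog & seq prog
| PrimRec of prog & prog
| Mu of prog.

(* [eval c xs y]: the program c halts on the arguments xs with output y.
   Recursion and minimisation are on the first argument. *)
Inductive eval : prog -> seq nat -> nat -> Prop :=
| eval_Zero xs : eval Zero xs 0
| eval_Succ x xs : eval Succ (x :: xs) x.+1
| eval_Proj i xs : eval (Proj i) xs (nth 0 xs i)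
| eval_Comp f gs xs ys z :
    size ys = size gs ->
    (forall i, i < size gs -> eval (nth Zero gs i) xs (nth 0 ys i)) ->
    eval f ys z ->
    eval (Comp f gs) xs z
| eval_PrimRec0 f g xs y :
    eval f xs y -> eval (PrimRec f g) (0 :: xs) y
| eval_PrimRecS f g n xs r y :
    eval (PrimRec f g) (n :: xs) r ->
    eval g (n :: r :: xs) y ->
    eval (PrimRec f g) (n.+1 :: xs) y
| eval_Mu f xs n (r : nat -> nat) :
    (forall m, m < n -> eval f (m :: xs) (r m).+1) ->
    eval f (n :: xs) 0 ->
    eval (Mu f) xs n.

Definition recursive (f : nat -> nat) : Prop :=
  exists c, forall x, eval c [:: x] (f x).

(* A binary relation is r.e. iff it is the domain of a binary partial recursive
   function; a numbering B : nat -> set nat is read as the relation "x \in B k",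
   so [re_rel B] says that B is uniformly r.e. *)
Definition re_rel (R : nat -> nat -> Prop) : Prop :=
  exists c, forall x y, R x y <-> exists z, eval c [:: x; y] z.

(* Acceptable: uniformly r.e., and every uniformly r.e. numbering reduces to W
   by a recursive translation of indices.  Constant numberings V show that
   every r.e. set occurs in W. *)
Definition acceptable_numbering (W : nat -> set nat) : Prop :=
  re_rel W /\
  forall V : nat -> set nat, re_rel V ->
    exists2 f : nat -> nat, recursive f & forall k, V k = W (f k).

Definition eq_class (eta : nat -> nat -> Prop) (x : nat) : set nat :=
  [set y | eta x y].

Definition positive_equivalence (eta : nat -> nat -> Prop) : Prop :=
  [/\ Equivalence eta, re_rel eta & infinite_set (range (eq_class eta))].

Definition eta_closure (eta : nat -> nat -> Prop) (A : set nat) : set nat :=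
  \bigcup_(x in A) eq_class eta x.

(* A union of classes: X chooses representatives of the classes involved. *)
Definition eta_closed (eta : nat -> nat -> Prop) (A : set nat) : Prop :=
  exists X : set nat, A = \bigcup_(x in X) eq_class eta x.

Definition eta_family (eta : nat -> nat -> Prop) (C : set (set nat)) : Prop :=
  [/\ infinite_set C,
      forall A, C A -> eta_closed eta A
    & exists B : nat -> set nat, [/\ re_rel B, injective B & range B = C]].

(* In texts and their initial segments [None] is the pause symbol #; in the
   output of a learner [None] is the symbol ?. *)
Definition text := nat -> option nat.

Definition text_for (L : set nat) (T : text) : Prop :=
  [set x | exists n, T n = Some x] = L.

Definition learner := seq (option nat) -> option nat.

Definition code_symbol (s : option nat) : nat :=
  if s is Some x then x.+1 else 0.

(* Recursiveness is with respect to the effective bijection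
   [CodeSeq.code : seq nat -> nat]. *)
Definition recursive_learner (M : learner) : Prop :=
  exists c, forall s : seq (option nat),
    eval c [:: CodeSeq.code (map code_symbol s)] (code_symbol (M s)).

(* [mkseq T n] is the initial segment T[n] of length n. *)
Definition outputs_converge (M : learner) (T : text) (v : option nat) : Prop :=
  exists n0, forall n, n0 <= n -> M (mkseq T n) = v.

Definition hyp (W : nat -> set nat) (eta : nat -> nat -> Prop) (e : nat)
  : set nat := eta_closure eta (W e).

Definition explanatorily_learns (W : nat -> set nat) (eta : nat -> nat -> Prop)
    (M : learner) (C : set (set nat)) : Prop :=
  forall L, C L -> forall T, text_for L T ->
    exists e, outputs_converge M T (Some e) /\ hyp W eta e = L.

(* On texts for sets outside the family, convergence to ? is allowed. *)
Definition confidently_learnable (W : nat -> set nat) (eta : nat -> nat -> Prop)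
    (C : set (set nat)) : Prop :=
  exists M, [/\ recursive_learner M,
                explanatorily_learns W eta M C
              & forall (L : set nat) (T : text), text_for L T ->
                  exists v, outputs_converge M T v].

Definition finitely_learns (W : nat -> set nat) (eta : nat -> nat -> Prop)
    (M : learner) (C : set (set nat)) : Prop :=
  forall L, C L -> forall T, text_for L T ->
    exists n e,
      [/\ forall m, m < n -> M (mkseq T m) = None,
          M (mkseq T n) = Some e,
          forall j, n <= j -> M (mkseq T j) = M (mkseq T n)
        & hyp W eta e = L].

Definition finitely_learnable (W : nat -> set nat) (eta : nat -> nat -> Prop)
    (C : set (set nat)) : Prop :=
  exists2 M, recursive_learner M & finitely_learns W eta M C.

(* Main.v *)
Require Import Defs.
From mathcomp Require Import all_boot.
From mathcomp Require Import boolp classical_sets functions cardinality.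

Set Implicit Arguments.
Unset Strict Implicit.
Unset Printing Implicit Defensive.

Local Open Scope classical_set_scope.

(* A finite learner of an infinite family must stay silent on every sequence
   of pauses, since such a sequence extends to a text for every member.  Hence
   the empty set lies in no finitely learnable infinite family, so adding it to
   the given family destroys finite learnability.  The enlarged family is
   confidently learnable: conjecture the empty set until the given finite
   learner outputs an index, and keep that index forever. *)

(** * Evaluation of programs and closure properties of computable functions *)

Lemma eval_det c xs y z : eval c xs y -> eval c xs z -> y = z.
Proof.
move=> Ey; elim: c xs y / Ey z.
- by move=> xs z Ez; inversion Ez.
- by move=> x xs z Ez; inversion Ez.
- by move=> i xs z Ez; inversion Ez.
- move=> f gs xs ys y sz_ys _ IHgs _ IHf z Ez.
  inversion Ez as [| | |f' gs' xs' ys' z' sz_ys' Egs' Ef'| | |]; subst.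
  suff eq_ys: ys = ys' by apply: IHf; rewrite eq_ys.
  apply: (@eq_from_nth _ 0); first by rewrite sz_ys sz_ys'.
  by move=> i; rewrite sz_ys => lt_i; apply: IHgs => //; apply: Egs'.
- by move=> f g xs y _ IHf z Ez; inversion Ez; apply: IHf.
- move=> f g n xs r y _ IHn _ IHg z Ez.
  inversion Ez as [| | | | |f' g' n' xs' r' z' En' Eg'|]; subst.
  by apply: IHg; rewrite (IHn _ En').
- move=> f xs n r _ IHpos _ IH0 z Ez.
  inversion Ez as [| | | | | |f' xs' n' r' Epos' E0']; subst.
  (* Were the two minima distinct, [f] would take the value 0 at the smaller one, where the other
     run records a successor. *)
  have [lt_nz|lt_zn|//] := ltngtP n z.
    by have := IH0 _ (Epos' _ lt_nz).
  by have := IHpos _ lt_zn _ E0'.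
Qed.

(** Programs carry no arity, so it is fixed here: nothing is required on lists of another size, and
    [computable_rec] can rebuild its parameter list from [k] projections. *)
Definition computable (k : nat) (f : seq nat -> nat) : Prop :=
  exists c, forall xs, size xs = k -> eval c xs (f xs).

Lemma eq_computable k f g : computable k f ->
  (forall xs, size xs = k -> f xs = g xs) -> computable k g.
Proof. by move=> [c Ec] fg; exists c => xs szx; rewrite -fg //; apply: Ec. Qed.

Lemma computable_nth k i : computable k (fun xs => nth 0 xs i).
Proof. by exists (Proj i) => xs _; constructor. Qed.

Lemma computable_all k (gs : seq (seq nat -> nat)) :
    (forall i, i < size gs -> computable k (nth (fun=> 0) gs i)) ->
  exists2 cs : seq prog, size cs = size gs &
    forall xs, size xs = k -> forall i, i < size cs ->
      eval (nth Zero cs i) xs (nth 0 [seq g xs | g <- gs] i).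
Proof.
elim: gs => [_|g gs IHgs gsP]; first by exists [::].
have [c Ec] := gsP 0 isT.
have [i lt_i|cs sz_cs Ecs] := IHgs; first by apply: (gsP i.+1).
exists (c :: cs) => /= [|xs szx [_|i lt_i]]; first by rewrite sz_cs.
  exact: Ec.
exact: Ecs.
Qed.

Lemma computable_comp k f gs : computable (size gs) f ->
    (forall i, i < size gs -> computable k (nth (fun=> 0) gs i)) ->
  computable k (fun xs => f [seq g xs | g <- gs]).
Proof.
move=> [c Ec] /computable_all[cs sz_cs Ecs]; exists (Comp c cs) => xs szx.
apply: (@eval_Comp _ _ _ [seq g xs | g <- gs]); first by rewrite size_map.
  by move=> i; apply: Ecs.
by apply: Ec; rewrite size_map.
Qed.

Lemma computable_comp1 k f g : computable 1 f -> computable k g ->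
  computable k (fun xs => f [:: g xs]).
Proof. by move=> fP gP; apply: (@computable_comp k f [:: g]) => // -[]. Qed.

Lemma computable_comp2 k f g h :
    computable 2 f -> computable k g -> computable k h ->
  computable k (fun xs => f [:: g xs; h xs]).
Proof.
by move=> fP gP hP; apply: (@computable_comp k f [:: g; h]) => // -[|[]].
Qed.

Lemma computable_comp3 k f g h l :
    computable 3 f -> computable k g -> computable k h -> computable k l ->
  computable k (fun xs => f [:: g xs; h xs; l xs]).
Proof.
move=> fP gP hP lP.
by apply: (@computable_comp k f [:: g; h; l]) => // -[|[|[]]].
Qed.

Lemma computable_recursive k f g : recursive f -> computable k g ->
  computable k (fun xs => f (g xs)).
Proof.
move=> [c Ec]; apply: (@computable_comp1 _ (fun ys => f (nth 0 ys 0))).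
by exists c => -[|x []].
Qed.

Lemma recursive_computable f : computable 1 (fun xs => f (nth 0 xs 0)) ->
  recursive f.
Proof. by move=> [c Ec]; exists c => x; apply: (Ec [:: x]). Qed.

Lemma computable_succ k f : computable k f -> computable k (fun xs => (f xs).+1).
Proof. by apply: (@computable_recursive k S); exists Succ => x; constructor. Qed.

Lemma computable_const k n : computable k (fun=> n).
Proof.
elim: n => [|n IHn]; first by exists Zero => xs _; constructor.
exact: computable_succ.
Qed.

Lemma computable_rec k f g h :
    computable k f -> computable k.+2 g -> computable k h ->
  computable k (fun xs =>
    nat_rect (fun=> nat) (f xs) (fun n r => g [:: n, r & xs]) (h xs)).
Proof.
move=> [cf Ef] [cg Eg] hP.
pose F ys := nat_rect (fun=> nat) (f (behead ys))
  (fun n r => g [:: n, r & behead ys]) (nth 0 ys 0).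
have FP: computable k.+1 F.
  exists (PrimRec cf cg) => -[|n xs] //= [szx]; rewrite /F /=.
  elim: n => [|n IHn] /=; first by apply/eval_PrimRec0/Ef.
  by apply: eval_PrimRecS IHn _; apply: Eg; rewrite /= szx.
(* [PrimRec] recurses on the head of its argument list, so the composition supplies the counter [h]
   there and copies the parameters behind it. *)
pose gs : seq (seq nat -> nat) := h :: mkseq (fun i xs => nth 0 xs i) k.
have /eq_computable: computable k (fun xs => F [seq g xs | g <- gs]).
  apply: computable_comp; first by rewrite /= size_mkseq.
  move=> [|i] //=; rewrite size_mkseq ltnS => lt_i.
  by rewrite nth_mkseq //; apply: computable_nth.
apply=> xs szx; rewrite /F /= -map_comp.
suff -> : [seq ((fun g => g xs) \o (fun i xs => nth 0 xs i)) i | i <- iota 0 k] = xs by [].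
by rewrite -[RHS](mkseq_nth 0) szx.
Qed.

Lemma computable_add k f g : computable k f -> computable k g ->
  computable k (fun xs => f xs + g xs).
Proof.
move=> fP gP; apply: (@computable_comp2 k (fun ys => nth 0 ys 0 + nth 0 ys 1)) => //.
(* Inside a recursion step, entry 0 is the counter, entry 1 the accumulator, and the parameters
   start at entry 2. *)
apply: eq_computable (computable_rec (computable_nth 2 0)
  (computable_succ (computable_nth 4 1)) (computable_nth 2 1)) _ => xs _ /=.
by elim: (nth 0 xs 1) => [|n /= ->]; rewrite ?addn0 ?addnS.
Qed.

Lemma computable_pred k f : computable k f -> computable k (fun xs => (f xs).-1).
Proof.
move=> fP; apply: (@computable_comp1 k (fun ys => (nth 0 ys 0).-1)) => //.
apply: eq_computable (computable_rec (computable_const 1 0)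
  (computable_nth 3 0) (computable_nth 1 0)) _ => xs _ /=.
by case: (nth 0 xs 0).
Qed.

Lemma computable_sub k f g : computable k f -> computable k g ->
  computable k (fun xs => f xs - g xs).
Proof.
move=> fP gP; apply: (@computable_comp2 k (fun ys => nth 0 ys 0 - nth 0 ys 1)) => //.
apply: eq_computable (computable_rec (computable_nth 2 0)
  (computable_pred (computable_nth 4 1)) (computable_nth 2 1)) _ => xs _ /=.
by elim: (nth 0 xs 1) => [|n /= ->]; rewrite ?subn0 ?subnS.
Qed.

Lemma computable_if0 k f g h :
    computable k f -> computable k g -> computable k h ->
  computable k (fun xs => if f xs == 0 then g xs else h xs).
Proof.
move=> fP gP hP; apply: (@computable_comp3 k
  (fun ys => if nth 0 ys 0 == 0 then nth 0 ys 1 else nth 0 ys 2)) => //.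
(* A step that ignores counter and accumulator turns recursion into case distinction; its entry 4 is
   the third parameter. *)
apply: eq_computable (computable_rec (computable_nth 3 1)
  (computable_nth 5 4) (computable_nth 3 0)) _ => xs _ /=.
by case: (nth 0 xs 0).
Qed.

Lemma computable_exp2 k f : computable k f -> computable k (fun xs => 2 ^ f xs).
Proof.
move=> fP; apply: (@computable_comp1 k (fun ys => 2 ^ nth 0 ys 0)) => //.
apply: eq_computable (computable_rec (computable_const 1 1)
  (computable_add (computable_nth 3 1) (computable_nth 3 1))
  (computable_nth 1 0)) _ => xs _ /=.
by elim: (nth 0 xs 0) => //= n ->; rewrite expnS mul2n addnn.
Qed.

(** Count up to the dividend, resetting the accumulator to 0 whenever it would reach the divisor. *)
Lemma computable_mod k f g : computable k f -> computable k g ->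
    (forall xs, size xs = k -> 0 < g xs) ->
  computable k (fun xs => f xs %% g xs).
Proof.
move=> fP gP g_gt0.
pose F ys := nat_rect (fun=> nat) 0
  (fun _ r => if nth 0 ys 1 - r.+1 == 0 then 0 else r.+1) (nth 0 ys 0).
have FP: computable 2 F.
  apply: eq_computable (computable_rec (computable_const 2 0) (computable_if0
    (computable_sub (computable_nth 4 3) (computable_succ (computable_nth 4 1)))
    (computable_const 4 0) (computable_succ (computable_nth 4 1)))
    (computable_nth 2 0)) _ => xs _ //=.
apply: eq_computable (computable_comp2 FP fP gP) _ => xs szx; rewrite /F /=.
have d_gt0 := g_gt0 xs szx; move: (g xs) d_gt0 => d d_gt0.
elim: (f xs) => [|m /= ->]; first by rewrite mod0n.
rewrite subn_eq0 modnS; have lt_md := ltn_pmod m d_gt0.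
(* The reset test agrees with the divisibility test of [modnS], since a remainder is less than
   [d]. *)
have -> : (d <= (m %% d).+1) = (d %| m.+1).
  rewrite {2}(divn_eq m d) -addnS dvdn_addr ?dvdn_mull //.
  have [le_d|] := leqP; last by move=> lt_d; rewrite gtnNdvd.
  by have /eqP <- : d == (m %% d).+1; rewrite ?dvdnn // eqn_leq le_d.
by [].
Qed.

(** * First defined values, and prefixes of coded sequences *)

Fixpoint first_some (T : Type) (u : nat -> option T) (n : nat) : option T :=
  if n is m.+1 then if first_some u m is Some x then Some x else u n else u 0.

Section FirstSome.
Variable T : Type.
Implicit Types u v : nat -> option T.

Lemma eq_first_some u v n : (forall i, i <= n -> u i = v i) ->
  first_some u n = first_some v n.
Proof.
elim: n => [|n IHn] /= uv; first exact: uv.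
by rewrite IHn ?uv // => i le_in; apply/uv/leqW.
Qed.

Lemma first_some_None u n :
  (forall i, i <= n -> u i = None) -> first_some u n = None.
Proof.
elim: n => [|n IHn] /= u0; first exact: u0.
by rewrite IHn ?u0 // => i le_in; apply/u0/leqW.
Qed.

Lemma first_some_stable u n m x :
  first_some u n = Some x -> n <= m -> first_some u m = Some x.
Proof.
move=> unx /subnKC <-; elim: (m - n) => [|p IHp]; first by rewrite addn0.
by rewrite addnS /= IHp.
Qed.

Lemma first_some_Some u n x :
    (forall i, i < n -> u i = None) -> u n = Some x ->
  first_some u n = Some x.
Proof. by case: n => //= n u0 ux; rewrite first_some_None. Qed.

Lemma first_some_None_last u n : first_some u n = None -> u n = None.
Proof. by case: n => //= n; case: first_some. Qed.

Lemma first_some_converges u :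
  exists o, exists n, forall m, n <= m -> first_some u m = o.
Proof.
have [[n [x unx]]|noS] := pselect (exists n x, first_some u n = Some x).
  by exists (Some x), n => m; apply: first_some_stable.
exists None, 0 => m _; case ux: (first_some u m) => [x|] //.
by case: noS; exists m, x.
Qed.

(** [K] climbs from 0 without skipping a value, and a repeated value adds nothing to the search.
    This serves to run through the prefixes of a sequence by truncating its code bit by bit. *)
Lemma first_some_slow u (K : nat -> nat) n :
    K 0 = 0 -> (forall j, K j.+1 = K j \/ K j.+1 = (K j).+1) ->
  first_some (u \o K) n = first_some u (K n).
Proof.
move=> K0 KS; elim: n => [|n /= ->]; first by rewrite /= K0.
have [->|->] //= := KS n.
by case un: first_some => [x|] //; apply: first_some_None_last.
Qed.

End FirstSome.

(* In binary, a code is a block 1 0 ... 0 for each entry, first entry lowest,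
   so truncating it to its j low bits leaves the code of a prefix. *)
Lemma code_mod_exp2 s : exists K : nat -> nat,
  [/\ K 0 = 0, forall j, K j.+1 = K j \/ K j.+1 = (K j).+1,
      forall j, K j <= size s &
      forall j, CodeSeq.code (take (K j) s) = CodeSeq.code s %% 2 ^ j].
Proof.
elim: s => [|n s [K [K0 KS Ks Kcode]]].
  by exists (fun=> 0); split=> // [j|j]; [left | rewrite mod0n].
(* The entry [n] fills the low [n.+1] bits: [n] zeros, then the 1 that completes it. Fewer bits give
   0, the code of the empty prefix. *)
exists (fun j => if j <= n then 0 else (K (j - n.+1)).+1); split=> //= j.
- have [lt_jn|lt_nj|->] := ltngtP j n; first by left.
    by rewrite subSn //; have [->|->] := KS (j - n.+1); [left | right].
  by right; rewrite subnn K0.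
- by have [_|_] := leqP j n; rewrite // ltnS.
have [/subnKC <-|lt_nj] := leqP j n.
  by rewrite expnD -mulnA modnMr.
rewrite /= Kcode -(subnKC lt_nj) addSnnS expnD -muln_modr expnS.
have -> : n + (j - n.+1).+1 - n.+1 = j - n.+1 by rewrite -addSnnS addKn.
congr (_ * _); move: (CodeSeq.code s) (j - n.+1) => c p.
have lt_r : c %% 2 ^ p < 2 ^ p by rewrite ltn_mod expn_gt0.
(* Keeping [p.+1] bits of [c.*2.+1] amounts to keeping [p] bits of [c] and restoring the final 1. *)
have -> : c.*2.+1 = c %/ 2 ^ p * (2 * 2 ^ p) + (c %% 2 ^ p).*2.+1.
  by rewrite {1}(divn_eq c (2 ^ p)) doubleD addnS -!mul2n mulnCA.
by rewrite modnMDl [RHS]modn_small // mul2n ltn_Sdouble.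
Qed.

(** * The committing learner and its recursiveness *)

Definition decode_symbol (n : nat) : option nat :=
  if n is x.+1 then Some x else None.

Lemma code_symbolK : cancel code_symbol decode_symbol.
Proof. by case. Qed.

Lemma decode_symbolK : cancel decode_symbol code_symbol.
Proof. by case. Qed.

Definition decode_segment (x : nat) : seq (option nat) :=
  map decode_symbol (CodeSeq.decode x).

(** A learner has no memory, so the first output of [M] is found anew among the prefixes of the
    current segment. *)
Definition commit (M : learner) (e : nat) : learner :=
  fun s => Some (odflt e (first_some (fun k => M (take k s)) (size s))).

Lemma commit_mkseq M e T n :
  commit M e (mkseq T n) = Some (odflt e (first_some (fun k => M (mkseq T k)) n)).
Proof.
rewrite /commit size_mkseq; congr (Some (odflt _ _)); apply: eq_first_some => k le_kn.
by rewrite /mkseq -map_take take_iota (minn_idPl le_kn).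
Qed.

(** No list operation has to be programmed: the prefixes of a segment with code [x] are exactly what
    the numbers [x %% 2 ^ j] with [j <= x] encode. *)
Lemma recursive_commit M e : recursive_learner M -> recursive_learner (commit M e).
Proof.
move=> [c Mc]; pose m x := code_symbol (M (decode_segment x)).
have mP : recursive m.
  exists c => x; have := Mc (decode_segment x).
  by rewrite /decode_segment -map_comp (eq_map decode_symbolK) map_id CodeSeq.decodeK.
(* The value 0 codes ?, so a nonzero [r] is the first output already found, and [e.+1] below codes
   [Some e]. *)
pose F x := nat_rect (fun=> nat) (m (x %% 2 ^ 0))
  (fun n r => if r == 0 then m (x %% 2 ^ n.+1) else r) x.
have FP : computable 1 (fun xs => F (nth 0 xs 0)).
  have mod_exp2 k i g : computable k g ->
      computable k (fun xs => m (nth 0 xs i %% 2 ^ g xs)).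
    move=> gP; apply: computable_recursive mP (computable_mod _ _ _).
    - exact: computable_nth.
    - exact: computable_exp2.
    - by move=> xs _; rewrite expn_gt0.
  apply: eq_computable (computable_rec (mod_exp2 _ 0 _ (computable_const 1 0))
    (computable_if0 (computable_nth 3 1)
      (mod_exp2 _ 2 _ (computable_succ (computable_nth 3 0)))
      (computable_nth 3 1)) (computable_nth 1 0)) _ => xs _ //.
have {FP} [d Ed] : recursive (fun x => if F x == 0 then e.+1 else F x).
  exact/recursive_computable/computable_if0/FP/computable_const.
exists d => s; set x := CodeSeq.code _.
suff <- : (if F x == 0 then e.+1 else F x) = code_symbol (commit M e s) by [].
have -> : F x = code_symbol (first_some (fun j => M (decode_segment (x %% 2 ^ j))) x).
  suff Fn n : nat_rect (fun=> nat) (m (x %% 2 ^ 0))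
      (fun n r => if r == 0 then m (x %% 2 ^ n.+1) else r) n =
      code_symbol (first_some (fun j => M (decode_segment (x %% 2 ^ j))) n).
    exact: Fn.
  by elim: n => //= n ->; case: first_some.
have [K [K0 KS Ks Kcode]] := code_mod_exp2 (map code_symbol s).
have take_K j : decode_segment (x %% 2 ^ j) = take (K j) s.
  rewrite /decode_segment -Kcode CodeSeq.codeK -map_take -map_comp.
  by rewrite (eq_map code_symbolK) map_id.
(* Since [x < 2 ^ x], the bound [x] on the search keeps every bit and so reaches the whole of
   [s]. *)
have Kx : K x = size s.
  rewrite -(size_map code_symbol) -(size_takel (Ks x)).
  congr size; apply: (can_inj CodeSeq.codeK).
  by rewrite Kcode modn_small // ltn_expl.
rewrite (@eq_first_some _ _ ((fun k => M (take k s)) \o K)) => [|j _]; last first.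
  by rewrite take_K.
by rewrite first_some_slow // Kx /commit; case: first_some.
Qed.

(** * Adding the empty set to a family *)

Lemma acceptable_empty W : acceptable_numbering W -> exists e, W e = set0.
Proof.
move=> [_ /(_ (fun=> set0))[|f _ f0]]; last by exists (f 0).
(* Minimising the constant 1 never halts, so [Mu c] shows the constant empty numbering to be
   uniformly r.e. *)
have [c Ec] := computable_const 3 1.
exists (Mu c) => k x; split=> // -[z Ez].
inversion Ez as [| | | | | |f' xs' n' r' _ E0]; subst.
by have := eval_det (Ec [:: z; k; x] erefl) E0.
Qed.

Lemma hyp_empty W eta e : W e = set0 -> hyp W eta e = set0.
Proof. by rewrite /hyp /eta_closure => ->; rewrite bigcup_set0. Qed.

Definition cons_empty (B : nat -> set nat) (k : nat) : set nat :=
  if k is j.+1 then B j else set0.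

(** A composition halts only if all its arguments do, so a second argument whose value is discarded
    can force divergence at index 0. *)
Lemma re_rel_cons_empty B : re_rel B -> re_rel (cons_empty B).
Proof.
move=> [c Bc].
have [p Ep] : computable 2 (fun xs => (nth 0 xs 0).-1).
  exact/computable_pred/computable_nth.
(* [Mu] puts its search variable first, so entry 1 is the index of the set. *)
have [g Eg] : computable 3 (fun xs => 1 - nth 0 xs 1).
  exact/computable_sub/computable_nth/computable_const.
(* [Mu g] halts on [:: k; x] exactly when k is positive. *)
exists (Comp (Proj 0) [:: Comp c [:: p; Proj 1]; Mu g]) => -[|k] x /=; split=> //.
- move=> [z Ez]; inversion Ez as [| | |f' gs' xs' ys z' _ Egs _| | |]; subst.
  have /= Emu := Egs 1 isT.
  inversion Emu as [| | | | | |f' xs' n' r' Epos E0]; subst.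
  by have := eval_det (Eg [:: _; 0; x] erefl) E0.
- move=> /(Bc k x)[z Ez]; exists z.
  (* At a positive index the guarding search succeeds at once, with value 0. *)
  apply: (@eval_Comp _ _ _ [:: z; 0]) => [//||]; last exact: (eval_Proj 0).
  move=> [_|[_|]] //=.
    apply: (@eval_Comp _ _ _ [:: k; x]) => // -[_|[_|]] //=.
      exact: (Ep [:: k.+1; x]).
    exact: (eval_Proj 1 [:: k.+1; x]).
  by apply: (@eval_Mu _ _ _ id) => //; apply: (Eg [:: 0; k.+1; x]).
- move=> [z Ez]; inversion Ez as [| | |f' gs' xs' ys z' _ Egs _| | |]; subst.
  have /= Ec := Egs 0 isT.
  inversion Ec as [| | |f' gs' xs' us z' sz_us Eus Eu| | |]; subst.
  apply/(Bc k x); exists (nth 0 ys 0); suff <- : us = [:: k; x] by [].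
  case: us sz_us Eus {Eu} => [|u [|v []]] //= _ Eus; congr [:: _; _].
    exact: eval_det (Eus 0 isT) (Ep [:: k.+1; x] erefl).
  exact: eval_det (Eus 1 isT) (eval_Proj 1 [:: k.+1; x]).
Qed.

Lemma eta_closed_set0 eta : eta_closed eta set0.
Proof. by exists set0; rewrite bigcup_set0. Qed.

Lemma eta_family_add_empty eta C : ~ C set0 ->
  eta_family eta C -> eta_family eta (set0 |` C).
Proof.
move=> C0 [Cinf Cclosed [B [Bre Binj Brange]]]; split.
- by apply: contra_not Cinf; apply: sub_finite_set => A CA; right.
- by move=> A [->|/Cclosed//]; apply: eta_closed_set0.
have B0 j : B j <> set0 by move=> Bj; apply: C0; rewrite -Bj -Brange; exists j.
exists (cons_empty B); split; first exact: re_rel_cons_empty.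
- move=> [|i] [|j] //=; first by move/esym/B0.
    by move/B0.
  by move=> eqB; congr _.+1; apply: Binj.
rewrite -Brange; apply/seteqP; split=> A.
  by move=> [[|j] _ <-]; [left | right; exists j].
by move=> [->|[j _ <-]]; [exists 0 | exists j.+1].
Qed.

(** * Finite learners on sequences of pauses *)

Definition pauses : text := fun=> None.

Lemma text_for_set0 T : text_for set0 T <-> T = pauses.
Proof.
split=> [T0|->]; last by apply/seteqP; split=> // x -[].
apply/funext => i; case Ti: (T i) => [x|//].
by have : set0 x by rewrite -T0; exists i.
Qed.

(** List [L] with a delay of [n] positions, pausing at each non-member. Texts are arbitrary
    functions, so membership may be tested classically. *)
Lemma text_after_pauses (L : set nat) n : exists2 T : text,
  text_for L T & forall m, m <= n -> mkseq T m = mkseq pauses m.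
Proof.
pose T : text := fun m =>
  if m < n then None else if m - n \in L then Some (m - n) else None.
exists T.
  apply/seteqP; split=> x /=.
    by move=> [m]; rewrite /T; case: ifP => // _; case: ifP => // /set_mem ? [<-].
  by move=> Lx; exists (n + x); rewrite /T ltnNge leq_addr addKn mem_set.
move=> m le_mn; apply/eq_in_map => i; rewrite mem_iota /T => lt_im.
by rewrite (leq_trans lt_im le_mn).
Qed.

(** An output [e] on [n] pauses could not be revised on any continuation, so every member of [C]
    would equal [hyp W eta e] and [C] would be finite. *)
Lemma finite_learner_pauses W eta M C n : infinite_set C ->
  finitely_learns W eta M C -> M (mkseq pauses n) = None.
Proof.
move=> Cinf MC; case Mn: (M _) => [e|//]; case: Cinf.
apply: (@sub_finite_set _ _ [set hyp W eta e]); last exact: finite_set1.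
move=> L CL /=; have [T TL Tn] := text_after_pauses L n.
have [k [d [Mlt Mk Mge <-]]] := MC _ CL _ TL.
(* Before stage [k] the learner outputs only ?; from [k] on its output is frozen, which forces [d]
   to be [e]. *)
have [lt_nk|le_kn] := ltnP n k.
  by have := Mlt _ lt_nk; rewrite Tn // Mn.
by have := Mge _ le_kn; rewrite Mk Tn // Mn => -[->].
Qed.

Lemma finitely_learnable_not_empty W eta C : infinite_set C ->
  finitely_learnable W eta C -> ~ C set0.
Proof.
move=> Cinf [M _ MC] C0.
have [n [e [_ Mn _ _]]] := MC _ C0 _ ((text_for_set0 pauses).2 erefl).
by rewrite (finite_learner_pauses n Cinf MC) in Mn.
Qed.

Theorem theorem5 (W : nat -> set nat) (hW : acceptable_numbering W)
    (eta : nat -> nat -> Prop) (heta : positive_equivalence eta) :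
  (exists C : set (set nat),
      eta_family eta C /\ finitely_learnable W eta C) ->
  exists C : set (set nat),
    [/\ eta_family eta C,
        confidently_learnable W eta C
      & ~ finitely_learnable W eta C].
Proof.
move=> [C [Cfam Cfin]]; have [Cinf _ _] := Cfam.
have C0 := finitely_learnable_not_empty Cinf Cfin.
have C'fam := eta_family_add_empty C0 Cfam; have [C'inf _ _] := C'fam.
exists (set0 |` C); split=> //; last first.
  by move/(finitely_learnable_not_empty C'inf); apply; left.
have [M Mrec MC] := Cfin; have [e We] := acceptable_empty hW.
exists (commit M e); split; first exact: recursive_commit.
- move=> L [->|CL] T TL.
    exists e; split; last exact: hyp_empty.
    exists 0 => n _; rewrite commit_mkseq first_some_None // => k _.
    by move/text_for_set0: TL => ->; apply: finite_learner_pauses Cinf MC.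
  have [n [d [Mlt Mn _ Ld]]] := MC _ CL _ TL.
  exists d; split=> //; exists n => m le_nm; rewrite commit_mkseq.
  by rewrite (first_some_stable (first_some_Some Mlt Mn) le_nm).
(* On any text whatever, [commit M e] changes its output at most once. *)
- move=> L T _; have [o [n on]] := first_some_converges (fun k => M (mkseq T k)).
  by exists (Some (odflt e o)), n => m le_nm; rewrite commit_mkseq on.
Qed.
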